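(* Let $\alpha>0$, $0<b<1$, $a=b^{-\alpha}$ and $\rho=1/b$. Let $\{Y(t),t\ge 0\}$ be an extremal process with stationary max-increments such that the distribution of $Y(1)$ is non-degenerate. Let $X_0\stackrel{d}{=}Y(1)$, let $\{\varepsilon_n\}_{n\ge 1}$ be i.i.d. random variables, independent of $X_0$, with $\varepsilon_n\stackrel{d}{=}\rho\,Y(b^{-\alpha}-1)$ for all $n$, and define $$X_n=\rho X_{n-1}\vee\varepsilon_n,\qquad n\ge 1 .$$ If $\{Y(t)\}$ is $(a,-\frac1\alpha)$-semi-selfsimilar, then the sequence $\{X_n\}$ is marginally stationary with extended Weibull type max-semi-stable$(a,b)$ marginals (with exponent $\alpha$). Conversely, if the sequence $\{X_n\}$ is marginally stationary, then $\{Y(t)\}$ is $(a,-\frac1\alpha)$-semi-selfsimilar and the marginals of $\{X_n\}$ are extended Weibull type max-semi-stable$(a,b)$ (with exponent $\alpha$).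
   Context: All random variables are real-valued; $x\vee y=\max(x,y)$. Extremal process (EP): a real-valued stochastic process $\{Y(t)\}$ with increasing right-continuous sample paths and independent max-increments: for $0<s<t$, $Y(t)=Y(s)\vee U_{s,t}$ with $U_{s,t}$ independent of $\{Y(r):r\le s\}$. It has stationary max-increments if the law of $U_{s,t}$ depends only on $t-s$, with univariate marginals $P(Y(t)\le u)=\{G(u)\}^{t}$ for all $t>0$, $u\in\mathbf{R}$, where $G$ is the distribution function of $Y(1)$. The univariate marginals of an EP determine its finite-dimensional distributions. All statements about the process concern times $t>0$. A non-degenerate distribution function $F$ is extended Weibull type max-semi-stable$(a,b)$ with exponent $\alpha>0$ if $0<b<1$, $a>1$, $ab^{\alpha}=1$ and $F(x)=\exp\{-|x|^{\alpha}h(\ln|x|)\}$ for $x<0$ (and $F(x)=1$ for $x\ge 0$), where $h$ is a positive bounded periodic function with period $|\ln b|$. Semi-selfsimilarity: for $c>0$ and $H\in\mathbf{R}$, $\{Y(t)\}$ is $(c,H)$-semi-selfsimilar if $\{Y(ct)\}\stackrel{d}{=}\{c^{H}Y(t)\}$ (equality of finite-dimensional distributions). In terms of the distribution function $G$ of $Y(1)$ this is equivalent to $\{G(c^{H}u)\}^{ct}=\{G(u)\}^{t}$. Marginally stationary means $X_n\stackrel{d}{=}X_{n-1}$ for all integers $n\ge 1$. *)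

(* Defs.v *)
From HB Require Import structures.
From mathcomp Require Import all_boot all_order all_algebra.
From mathcomp Require Import all_classical all_reals all_analysis.

Set Implicit Arguments.
Unset Strict Implicit.
Unset Printing Implicit Defensive.

Import Order.TTheory GRing.Theory Num.Theory.
Import numFieldNormedType.Exports.

Local Open Scope classical_set_scope.
Local Open Scope ring_scope.

(* Equality in law of two random elements of E, possibly defined on different
   probability spaces. *)
Definition eq_law {d1 d2 d : measure_display} {R : realType}
    {T1 : measurableType d1} {T2 : measurableType d2} {E : measurableType d}
    (P1 : probability T1 R) (P2 : probability T2 R)
    (X1 : T1 -> E) (X2 : T2 -> E) : Prop :=
  forall A : set E, measurable A -> P1 (X1 @^-1` A) = P2 (X2 @^-1` A).

Definition nondegenerate_rv {d : measure_display} {R : realType}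
    {T : measurableType d} (P : probability T R) (X : {RV P >-> R}) : Prop :=
  ~ exists c : R, distribution P X [set c] = 1%E.

(* The sigma-algebra generated by the family (X i), i in J. *)
Definition sigma_family {d : measure_display} {R : realType}
    {T : measurableType d} {I : Type} (X : I -> T -> R) (J : set I) :
    set (set T) :=
  <<s \bigcup_(i in J) preimage_set_system [set: T] (X i) measurable >>.

(* X is independent of the whole family (Z i), i in J. *)
Definition independent_of_family {d : measure_display} {R : realType}
    {T : measurableType d} (P : probability T R) {I : Type}
    (X : T -> R) (Z : I -> T -> R) (J : set I) : Prop :=
  forall (A : set R) (B : set T), measurable A -> sigma_family Z J B ->
    P (X @^-1` A `&` B) = (P (X @^-1` A) * P B)%E.

Definition mutually_independent {d : measure_display} {R : realType}
    {T : measurableType d} (P : probability T R) {I : eqType}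
    (Z : I -> T -> R) (J : set I) : Prop :=
  forall (s : seq I) (A : I -> set R), uniq s ->
    (forall i, i \in s -> J i) -> (forall i, i \in s -> measurable (A i)) ->
    P (\big[setI/[set: T]]_(i <- s) (Z i @^-1` A i)) =
    (\prod_(i <- s) P (Z i @^-1` A i))%E.

(* Only the values Y t with 0 < t matter in the definitions below; U s t is the
   max-increment of Y over ]s, t]. *)
Definition extremal_process {d : measure_display} {R : realType}
    {T : measurableType d} (P : probability T R)
    (Y : R -> {RV P >-> R}) (U : R -> R -> {RV P >-> R}) : Prop :=
  [/\ forall (w : T) (s t : R), 0 < s -> s <= t -> Y s w <= Y t w,
      forall (w : T) (t : R), 0 < t -> Y s w @[s --> t^'+] --> Y t w,
      forall s t : R, 0 < s -> s < t ->
        {ae P, forall w, Y t w = Num.max (Y s w) (U s t w)} &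
      forall s t : R, 0 < s -> s < t ->
        independent_of_family P (U s t) (fun r => Y r : T -> R)
          [set r | 0 < r <= s]].

Definition stationary_extremal_process {d : measure_display} {R : realType}
    {T : measurableType d} (P : probability T R)
    (Y : R -> {RV P >-> R}) : Prop :=
  exists U : R -> R -> {RV P >-> R},
    [/\ extremal_process Y U,
        forall s t s' t' : R, 0 < s -> s < t -> 0 < s' -> s' < t' ->
          t - s = t' - s' -> eq_law P P (U s t) (U s' t') &
        forall t u : R, 0 < t -> cdf (Y t) u = (cdf (Y 1%R) u `^ t)%E].

Definition semi_selfsimilar {d : measure_display} {R : realType}
    {T : measurableType d} (P : probability T R)
    (c H : R) (Y : R -> {RV P >-> R}) : Prop :=
  forall (k : nat) (t : 'I_k -> R), (forall i, 0 < t i) ->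
    eq_law P P (fun w => [tuple Y (c * t i) w | i < k])
               (fun w => [tuple c `^ H * Y (t i) w | i < k]).

(* The law of X is extended Weibull type max-semi-stable(a, b) with exponent
   alpha. *)
Definition ext_weibull_mss {d : measure_display} {R : realType}
    {T : measurableType d} (P : probability T R)
    (alpha a b : R) (X : {RV P >-> R}) : Prop :=
  [/\ nondegenerate_rv X,
      [/\ 0 < alpha, 0 < b < 1, 1 < a & a * b `^ alpha = 1] &
      exists h : R -> R,
        [/\ forall x, 0 < h x,
            exists M : R, forall x, h x <= M,
            forall x, h (x + `|ln b|) = h x,
            forall x, x < 0 ->
              cdf X x = (expR (- (`|x| `^ alpha * h (ln `|x|))))%:E &
            forall x, 0 <= x -> cdf X x = 1%E]].

Definition marginally_stationary {d : measure_display} {R : realType}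
    {T : measurableType d} (P : probability T R)
    (X : nat -> {RV P >-> R}) : Prop :=
  forall n : nat, (1 <= n)%N -> eq_law P P (X n) (X n.-1).

(* Main.v *)
Require Import Defs.
From HB Require Import structures.
From mathcomp Require Import all_boot all_order all_algebra.
From mathcomp Require Import all_classical all_reals all_analysis.
From mathcomp Require Import measurable_realfun ring lra.

Set Implicit Arguments.
Unset Strict Implicit.
Unset Printing Implicit Defensive.

Import Order.TTheory GRing.Theory Num.Theory.
Import numFieldNormedType.Exports.

Local Open Scope classical_set_scope.
Local Open Scope ring_scope.

(* With G the distribution function of Y(1), the recursion gives
   P(X_n <= u) = P(X_(n-1) <= b u) G(b u)^(a - 1), because X_(n-1) depends only
   on X_0, eps_1, ..., eps_(n-1); so marginal stationarity and the case k = t = 1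
   of semi-selfsimilarity both amount to G(u / b) = G(u)^a.  This equation forces
   G = 1 on [0, +oo[ and 0 < G < 1 on ]-oo, 0[, and makes
   h(y) = - ln G(- e^y) e^(- alpha y) periodic of period - ln b.  It yields
   semi-selfsimilarity of all finite-dimensional distributions by removing the
   latest time: given the past up to s, the event Y(t) <= u, s <= t, amounts to
   Y(s) <= u up to an independent factor G(u)^(t - s). *)

(** * Finite systems of upper bounds and the sigma-algebra they generate *)

Section Events.
Context {d : measure_display} {T : measurableType d} {R : realType} {I : Type}.
Variable Z : I -> T -> R.

(** Constraints form a list, with repeated indices allowed, so that concatenation becomes
    intersection and these events form a pi-system. *)
Definition le_event (s : seq (I * R)) : set T :=
  [set w | all (fun p => Z p.1 w <= p.2) s].

Lemma le_event_nil : le_event [::] = setT.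
Proof. by rewrite predeqE. Qed.

Lemma le_event_cons i u s :
  le_event ((i, u) :: s) = Z i @^-1` `]-oo, u] `&` le_event s.
Proof.
apply/seteqP; split => w; rewrite /le_event/= in_itv/=; first by case/andP.
by move=> [-> ->].
Qed.

Lemma le_event_cat s1 s2 : le_event (s1 ++ s2) = le_event s1 `&` le_event s2.
Proof.
apply/seteqP; split => w; rewrite /le_event/= all_cat; first by case/andP.
by move=> [-> ->].
Qed.

Lemma setI_closed_le_event : setI_closed (range le_event).
Proof. by move=> _ _ [s1 _ <-] [s2 _ <-]; exists (s1 ++ s2) => //; rewrite le_event_cat. Qed.

Lemma sigma_family_le (J : set I) i u :
  J i -> sigma_family Z J (Z i @^-1` `]-oo, u]).
Proof.
move=> Ji; apply: sub_sigma_algebra; exists i => //.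
by exists `]-oo, u]%classic => //; rewrite setTI.
Qed.

Lemma sigma_family_setI (J : set I) A B :
  sigma_family Z J A -> sigma_family Z J B -> sigma_family Z J (A `&` B).
Proof. exact: (@measurableI _ (g_sigma_algebraType _)). Qed.

Lemma sigma_family_setT (J : set I) : sigma_family Z J setT.
Proof. exact: (@measurableT _ (g_sigma_algebraType _)). Qed.

Lemma sigma_family_measurable (J : set I) A :
  (forall i, measurable_fun setT (Z i)) ->
  sigma_family Z J A -> measurable A.
Proof.
move=> mZ; apply: smallest_sub => //; first exact: sigma_algebra_measurable.
by move=> _ [i _ [B mB <-]]; exact: mZ.
Qed.

Lemma sigma_family_le_event_generated A :
  sigma_family Z setT A -> <<s range le_event >> A.
Proof.
apply: smallest_sub; first exact: smallest_sigma_algebra.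
move=> _ [i _ [B mB <-]].
have : measurable_fun [set: g_sigma_algebraType (range le_event)] (Z i).
  (* The open rays []u, +oo[] generate the Borel sets, and their preimages are complements of
     one-constraint events. *)
  apply: (measurability _ (RGenOInfty.measurableE R)).
  move=> _ [_ [u ->] <-]; rewrite setTI -setCitvl preimage_setC.
  apply: measurableC; apply: sub_sigma_algebra; exists [:: (i, u)] => //.
  by rewrite le_event_cons le_event_nil setIT.
by move=> /(_ measurableT _ mB).
Qed.

End Events.

(** * Equality in law tested on upper-bound events *)

Lemma eq_law_le_event {d1 d2 d : measure_display} {R : realType}
    {T1 : measurableType d1} {T2 : measurableType d2} {E : measurableType d}
    (P1 : probability T1 R) (P2 : probability T2 R)
    (X1 : T1 -> E) (X2 : T2 -> E) {I : Type} (f : I -> E -> R) :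
  (forall i, measurable_fun setT (f i)) ->
  @measurable _ E `<=` sigma_family f setT ->
  measurable_fun setT X1 -> measurable_fun setT X2 ->
  (forall s, P1 (X1 @^-1` le_event f s) = P2 (X2 @^-1` le_event f s)) ->
  eq_law P1 P2 X1 X2.
Proof.
move=> mf Esub mX1 mX2 fE A mA.
pose m1 : {measure set E -> \bar R} :=
  measure_function_pushforward__canonical__measure_function_Measure P1 mX1.
pose m2 : {measure set E -> \bar R} :=
  measure_function_pushforward__canonical__measure_function_Measure P2 mX2.
(* Uniqueness of measures on a generating pi-system. The constant sequence [setT], the event of the
   empty list, is the exhausting sequence of finite measure. *)
apply: (@measure_unique _ R E (range (le_event f)) (fun=> setT) _ _ _ _ m1 m2) => //.
- apply/seteqP; split => B.
    by move=> /Esub; exact: sigma_family_le_event_generated.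
  apply: smallest_sub; first exact: sigma_algebra_measurable.
  move=> _ [s _ <-]; elim: s => [|[i u] s IH]; first by rewrite le_event_nil.
  rewrite le_event_cons; apply: measurableI => //.
  by rewrite -[X in measurable X]setTI; exact: mf.
- exact: setI_closed_le_event.
- by move=> _; exists [::] => //; rewrite le_event_nil.
- by apply/seteqP; split => // x _; exists 0%N.
- by move=> _ [s _ <-]; exact: fE.
- by move=> _; rewrite /m1/= /pushforward preimage_setT probability_setT ltry.
Qed.

Lemma eq_law_cdf {d1 d2 : measure_display} {R : realType}
    {T1 : measurableType d1} {T2 : measurableType d2}
    (P1 : probability T1 R) (P2 : probability T2 R)
    (X1 : {RV P1 >-> R}) (X2 : {RV P2 >-> R}) :
  cdf X1 =1 cdf X2 -> eq_law P1 P2 X1 X2.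
Proof.
move=> XX; apply: (@eq_law_le_event _ _ _ _ _ _ _ _ _ _ _ unit (fun=> idfun)) => //.
  by move=> _; exact: measurable_id.
  move=> A mA; apply: sub_sigma_algebra; exists tt => //.
  by exists A => //; rewrite setTI.
move=> s.
(* Several bounds on a single variable collapse to the smallest one. *)
have [->|[u ->]] : le_event (fun _ : unit => idfun : R -> R) s = setT \/
    exists u, le_event (fun _ : unit => idfun : R -> R) s = `]-oo, u]%classic.
  elim: s => [|[i u] s]; first by rewrite le_event_nil; left.
  rewrite le_event_cons => -[->|[v ->]]; right.
    by exists u; rewrite setIT.
  exists (Num.min u v); apply/seteqP; split => x; rewrite /= !in_itv/=.
    by rewrite le_min => -[-> ->].
  by rewrite le_min => /andP.
- by rewrite !preimage_setT !probability_setT.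
- exact: XX.
Qed.

Lemma eq_law_tuple {d1 d2 : measure_display} {R : realType}
    {T1 : measurableType d1} {T2 : measurableType d2}
    (P1 : probability T1 R) (P2 : probability T2 R) (k : nat)
    (X1 : 'I_k -> T1 -> R) (X2 : 'I_k -> T2 -> R) :
  (forall i, measurable_fun setT (X1 i)) ->
  (forall i, measurable_fun setT (X2 i)) ->
  (forall s, P1 (le_event X1 s) = P2 (le_event X2 s)) ->
  eq_law P1 P2 (fun w => [tuple X1 i w | i < k]) (fun w => [tuple X2 i w | i < k]).
Proof.
move=> mX1 mX2 XX.
apply: (@eq_law_le_event _ _ _ _ _ _ _ _ _ _ _ 'I_k (fun i v => tnth v i)).
- by move=> i; exact: measurable_tnth.
- move=> A; apply: smallest_sub; first exact: smallest_sigma_algebra.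
  move=> B; rewrite -bigcup_seq => -[i _ mB]; apply: sub_sigma_algebra.
  by exists i.
- apply/measurable_fun_tnthP => i.
  by apply: eq_measurable_fun (mX1 i) => w _; rewrite /= tnth_mktuple.
- apply/measurable_fun_tnthP => i.
  by apply: eq_measurable_fun (mX2 i) => w _; rewrite /= tnth_mktuple.
- suff E d' (T' : measurableType d') (X : 'I_k -> T' -> R) s :
      (fun w => [tuple X i w | i < k]) @^-1` le_event (fun i v => tnth v i) s
      = le_event X s by move=> s; rewrite !E.
  transitivity (le_event (fun i w => tnth [tuple X j w | j < k] i) s) => //.
  congr (le_event _ s); apply/funext => i; apply/funext => w.
  exact: tnth_mktuple.
Qed.

(** Adding the exceptional null set to both intersections makes them equal without changing their
    measures. *)
Lemma measure_setI_ae {d : measure_display} {T : measurableType d} {R : realType}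
    (mu : {measure set T -> \bar R}) (A B C : set T) :
  measurable A -> measurable B -> measurable C ->
  {ae mu, forall w, B w <-> C w} -> mu (A `&` B) = mu (A `&` C).
Proof.
move=> mA mB mC [N [mN N0 BCN]].
have mI D : measurable D -> measurable (A `&` D) by exact: measurableI.
rewrite -(measureU0 (mI _ mB) mN N0) -(measureU0 (mI _ mC) mN N0).
congr (mu _); apply/seteqP.
have BC w : ~ N w -> (B w <-> C w).
  by move=> nN; apply: contrapT => h; apply: nN; exact: BCN.
split => w [[Aw Dw]|Nw]; try (by right); have [Nw|/BC h] := pselect (N w);
  by [right|left; split => //; apply/h].
Qed.

(** * Removing the latest time of an extremal process *)

Section ExtremalProcess.
Context {d : measure_display} {T : measurableType d} {R : realType}.
Context (P : probability T R) (Y : R -> {RV P >-> R}).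
Hypothesis hY : stationary_extremal_process Y.

Let measurable_le (X : {RV P >-> R}) (u : R) : measurable (X @^-1` `]-oo, u]).
Proof. by rewrite -[X in measurable X]setTI; exact: measurable_funP. Qed.

(** Almost surely [Y t] is the maximum of [Y s] and [U s t], and the latter is independent of the
    past, so the factor is the probability of [U s t <= u]. The marginals identify it by division
    when the distribution function is nonzero at [u]. *)
Lemma extremal_process_step (s t u : R) (B : set T) :
  0 < s -> s <= t -> sigma_family (fun r => Y r : T -> R) [set r | 0 < r <= s] B ->
  P (Y t @^-1` `]-oo, u] `&` B) =
  (P (Y s @^-1` `]-oo, u] `&` B) * cdf (Y 1) u `^ (t - s))%E.
Proof.
move=> s0; rewrite le_eqVlt => /predU1P[<-|st] sB.
  by rewrite subrr poweRe0 mule1.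
have [U [[_ _ Ymax Uindep] _ Ycdf]] := hY.
have sYs : sigma_family (fun r => Y r : T -> R) [set r | 0 < r <= s]
    (Y s @^-1` `]-oo, u]).
  by apply: sigma_family_le => /=; rewrite s0 lexx.
have split_max C : sigma_family (fun r => Y r : T -> R) [set r | 0 < r <= s] C ->
    P (Y t @^-1` `]-oo, u] `&` C) =
    (P (Y s @^-1` `]-oo, u] `&` C) * P (U s t @^-1` `]-oo, u]))%E.
  move=> sC.
  have mC : measurable C.
    by apply: sigma_family_measurable sC => i; exact: measurable_funP.
  rewrite setIC (measure_setI_ae mC (measurable_le (Y t) u)
    (measurableI _ _ (measurable_le (Y s) u) (measurable_le (U s t) u))); last first.
    apply: filterS (Ymax _ _ s0 st) => w /= ->.
    by rewrite !in_itv/= ge_max; split => [/andP[]|[-> ->]].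
  rewrite setIA setIC muleC [in RHS]setIC.
  by apply: (Uindep _ _ s0 st) => //; exact: sigma_family_setI.
rewrite split_max//.
have t0 : 0 < t by exact: lt_trans st.
(* The trivial past event gives G(u)^t = G(u)^s P(U <= u), with G the distribution function of
   [Y 1]. *)
have GU := split_max _ (@sigma_family_setT _ _ _ _ _ _).
have PE r : P (Y r @^-1` `]-oo, u]) = cdf (Y r) u by [].
rewrite !setIT !PE (Ycdf t)// (Ycdf s)// in GU.
(* The law of [U s t] is not determined where [G] vanishes. *)
have [G0|G0] := eqVneq (cdf (Y 1) u) 0%E.
  suff -> : P (Y s @^-1` `]-oo, u] `&` B) = 0%E by rewrite !mul0e.
  apply/eqP; rewrite eq_le measure_ge0 andbT.
  rewrite -[leRHS](_ : cdf (Y s) u = 0%E); last by rewrite Ycdf// G0 poweR0r// gt_eqF.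
  apply: le_measure; rewrite ?inE//.
  apply: measurableI => //.
  by apply: sigma_family_measurable sB => i; exact: measurable_funP.
have Gfin : cdf (Y 1) u \is a fin_num by exact: fin_num_measure.
have Gpos : 0 < fine (cdf (Y 1) u).
  by rewrite fine_gt0// lt0e G0 cdf_ge0/= -ge0_fin_numE ?cdf_ge0.
rewrite -(fineK Gfin) !poweR_EFin in GU *; congr (_ * _)%E.
move: GU.
have [x Ux] : exists x, P (U s t @^-1` `]-oo, u]) = x%:E.
  by exists (fine (P (U s t @^-1` `]-oo, u]))); rewrite fineK// fin_num_measure.
rewrite Ux -EFinM => -[GU]; congr EFin.
apply: (@mulfI _ (fine (cdf (Y 1) u) `^ s)).
  by rewrite gt_eqF// powR_gt0.
rewrite -GU -powRD; last by rewrite (gt_eqF Gpos) implybT.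
by rewrite addrC subrK.
Qed.

End ExtremalProcess.

(** Passes from the one-dimensional scaling relation to all finite-dimensional distributions. The
    exponent 0 in that relation covers repeated times. *)
Lemma extremal_process_le_event {d : measure_display} {T : measurableType d}
    {R : realType} (P : probability T R) (Y : R -> {RV P >-> R}) (c k : R) :
  stationary_extremal_process Y -> 0 < c -> 0 < k ->
  (forall u t, 0 <= t -> (cdf (Y 1%R) u `^ (c * t) = cdf (Y 1%R) (u / k) `^ t)%E) ->
  forall s : seq (R * R), all (fun p => 0 < p.1) s ->
  P (le_event (fun t => Y (c * t)) s) = P (le_event (fun t w => k * Y t w) s).
Proof.
move=> hY c0 k0 GG.
have Ycdf t u : 0 < t -> (cdf (Y t) u = cdf (Y 1%R) u `^ t)%E.
  by case: hY => U [_ _]; exact.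
have YkE t u : (fun w => k * Y t w) @^-1` `]-oo, u] = Y t @^-1` `]-oo, u / k].
  by apply/seteqP; split => w; rewrite /= !in_itv/= ler_pdivlMr// mulrC.
(* Times are sorted in decreasing order, so that the head of the list is the latest one. *)
pose later := fun p q : R * R => q.1 <= p.1.
have later_trans : transitive later by move=> p q r /[swap]; exact: le_trans.
have min_event (Z : T -> R) u v :
    Z @^-1` `]-oo, u] `&` Z @^-1` `]-oo, v] = Z @^-1` `]-oo, Num.min u v].
  by apply/seteqP; split => w; rewrite /= !in_itv/= le_min; [move=> [-> ->]|move/andP].
have key s t u : all (fun p => 0 < p.1) s -> 0 < t -> path later (t, u) s ->
    P (le_event (fun t => Y (c * t)) ((t, u) :: s)) =
    P (le_event (fun t w => k * Y t w) ((t, u) :: s)).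
  elim: s t u => [|[t' u'] s IH] t u.
    move=> _ t0 _; rewrite !le_event_cons !le_event_nil !setIT YkE.
    have := Ycdf (c * t) u; rewrite /cdf/distribution/pushforward => ->; last exact: mulr_gt0.
    have := Ycdf t (u / k) t0; rewrite /cdf/distribution/pushforward => ->.
    exact: (GG _ _ (ltW t0)).
  move=> /= /andP[t'0 s0] t0 /andP[t't ps].
  (* [Y (c * r)] needs the past of [Y] up to [c * t'], and [k * Y r] up to [t']. *)
  have sub_past b : 0 < b -> all (fun p : R * R => 0 < b * p.1 <= b * t') s.
    move=> b0; have ops := order_path_min later_trans ps.
    have : all (predI (fun p : R * R => 0 < p.1) (later (t', u'))) s.
      by rewrite all_predI s0.
    by apply: sub_all => p /= /andP[p0 pt]; rewrite mulr_gt0//= ler_pM2l.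
  (* Treats both processes at once: [Y (c * r)] with [b = c], and [k * Y r] with [b = 1]. *)
  have past b (Z : R -> T -> R) v : 0 < b ->
      (forall r u, exists u', Z r @^-1` `]-oo, u] = Y (b * r) @^-1` `]-oo, u']) ->
      sigma_family (fun r => Y r : T -> R) [set r | 0 < r <= b * t']
        (le_event Z ((t', v) :: s)).
    move=> b0 ZY.
    have sZ r u0 : 0 < b * r <= b * t' ->
        sigma_family (fun r => Y r : T -> R) [set r | 0 < r <= b * t']
          (Z r @^-1` `]-oo, u0]).
      by move=> rt; have [u1 ->] := ZY r u0; exact: sigma_family_le.
    rewrite le_event_cons; apply: sigma_family_setI.
      by apply: sZ; rewrite mulr_gt0//=.
    move: (sub_past b b0); elim: s {IH s0 ps sub_past} => [_|[r u0] s IHs /= /andP[rt st]].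
      by rewrite le_event_nil; exact: sigma_family_setT.
    by rewrite le_event_cons; apply: sigma_family_setI; [exact: sZ|exact: IHs].
  rewrite [in LHS]le_event_cons (extremal_process_step hY _ (mulr_gt0 c0 t'0)); last 2 first.
    by rewrite ler_pM2l.
    by apply: (past c (fun r => Y (c * r))) => // r u0; exists u0.
  rewrite [in RHS]le_event_cons YkE (extremal_process_step hY _ t'0 t't); last first.
    have := past 1 (fun r w => k * Y r w) u' ltr01; rewrite mul1r; apply => r u0.
    by exists (u0 / k); rewrite mul1r YkE.
  rewrite -mulrBr GG ?subr_ge0//; congr (_ * _)%E.
  (* The bound [u], moved from [t] to [t'], merges with [u'] into their minimum, which leaves one
     constraint fewer. *)
  have ps' : path later (t', Num.min u u') s by case: (s) ps.
  have := IH t' (Num.min u u') s0 t'0 ps'.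
  by rewrite !le_event_cons -!min_event -!setIA YkE.
move=> s s0; set s' := sort later s.
have E (Z : R -> T -> R) : le_event Z s = le_event Z s'.
  by rewrite /le_event; apply/seteqP; split => w; rewrite /= all_sort.
rewrite !E; have : sorted later s'.
  by apply: sort_sorted => p q; exact: le_total.
have : all (fun p : R * R => 0 < p.1) s' by rewrite all_sort.
case: s' {E} => [|[t u] s'']; first by rewrite !le_event_nil.
by move=> /= /andP[t0 s''0]; exact: key.
Qed.

(** * Elementary facts on powers and periodic functions *)

Lemma expr_unbounded (R : realType) (r M : R) : 1 < r -> exists n, M <= r ^+ n.
Proof.
move=> r1; have r0 : 0 < r by exact: lt_trans r1.
have : (r^-1 ^+ n) @[n --> \oo] --> (0 : R).
  by apply: cvg_expr; rewrite gtr0_norm ?invr_gt0// invf_lt1.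
have M0 : 0 < Num.max M 1 by rewrite lt_max ltr01 orbT.
move=> /cvgrPdist_lt/(_ (Num.max M 1)^-1); rewrite invr_gt0 => /(_ M0) [n _].
move=> /(_ n (leqnn n)) /=; rewrite sub0r normrN gtr0_norm ?exprn_gt0 ?invr_gt0//.
rewrite exprVn ltf_pV2 ?posrE ?exprn_gt0// => h; exists n.
by apply: ltW; apply: le_lt_trans h; rewrite le_max lexx.
Qed.

Lemma periodic_intz (R : realType) (h : R -> R) (p : R) (m : int) (x : R) :
  (forall y, h (y + p) = h y) -> h (x + m%:~R * p) = h x.
Proof.
move=> hp; have nat_per (n : nat) y : h (y + n%:R * p) = h y.
  by elim: n => [|n IH]; rewrite ?mul0r ?addr0// -natr1 mulrDl mul1r addrA hp.
case: m => n; first exact: nat_per.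
by have := nat_per n.+1 (x - n.+1%:R * p); rewrite subrK NegzE mulrNz mulNr.
Qed.

Lemma powRN_gt1 (R : realType) (x p : R) : 0 < x < 1 -> 0 < p -> 1 < x `^ (- p).
Proof.
move=> /andP[x0 x1] p0; rewrite powRN invf_gt1 ?powR_gt0//.
have := @gt0_ltr_powR _ _ p0 x 1; rewrite !nnegrE powR1.
by apply => //; exact: ltW.
Qed.

(** * Distribution functions satisfying F(u / b) = F(u)^a *)

Section ExtendedWeibull.
Context {R : realType} {d : measure_display} {T : measurableType d}.
Context {P : probability T R} (X : {RV P >-> R}) (alpha b : R).
Hypotheses (alpha0 : 0 < alpha) (b01 : 0 < b < 1) (Xnd : nondegenerate_rv X).
Hypothesis semistable :
  forall u, (cdf X (u / b) = cdf X u `^ (b `^ (- alpha)))%E.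

Let a := b `^ (- alpha).
Let F x := fine (cdf X x).

Let b0 : 0 < b. Proof. by case/andP: b01. Qed.
Let b1 : b < 1. Proof. by case/andP: b01. Qed.
Let r1 : 1 < b^-1. Proof. by rewrite invf_gt1. Qed.

Let a1 : 1 < a. Proof. exact: powRN_gt1. Qed.
Let a0 : 0 < a. Proof. exact: lt_trans a1. Qed.

Let cdfE x : cdf X x = (F x)%:E.
Proof. by rewrite /F fineK// fin_num_measure. Qed.

Let F0 x : 0 <= F x. Proof. by rewrite -lee_fin -cdfE cdf_ge0. Qed.

Let F1 x : F x <= 1. Proof. by rewrite -lee_fin -cdfE cdf_le1. Qed.

Let Fmono x y : x <= y -> F x <= F y.
Proof. by move=> xy; rewrite -lee_fin -!cdfE cdf_nondecreasing. Qed.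

Let Fa u : F (u / b) = F u `^ a.
Proof. by have := semistable u; rewrite !cdfE poweR_EFin => -[]. Qed.

(** For F(x) > 0, logarithms give (1 - a) ln F(x) = 0, with a > 1. *)
Let F_fixed (x : R) : F x = F x `^ a -> F x = 0 \/ F x = 1.
Proof.
have [->|Fx0] := eqVneq (F x) 0; first by left.
move=> h; right; have Fx : 0 < F x by rewrite lt_def Fx0 F0.
apply/eqP; rewrite -ln_eq0//; have /(congr1 (@ln R)) := h.
rewrite ln_powR => /eqP; rewrite -subr_eq0 -{1}(mul1r (ln _)) -mulrBl mulf_eq0.
by rewrite subr_eq0 (lt_eqF a1).
Qed.

Let F_cvg1 : exists M, forall x, M <= x -> 0 < F x.
Proof.
have /fine_cvgP[_ /cvgrPdist_lt/(_ _ ltr01)] := @cvg_cdfy1 _ _ _ _ X.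
(* Neighbourhoods of infinity are open rays, hence the shift by 1. *)
move=> [M [_ h]]; exists (M + 1) => x Mx.
have /h /= : M < x by apply: lt_le_trans Mx; rewrite ltrDl.
rewrite -/(F x) => /ltr_normlP[_]; rewrite ltrBlDr -ltrBlDl; nra.
Qed.

Let F_cvg0 : exists M, forall x, x <= M -> F x < 1.
Proof.
have /fine_cvgP[_ /cvgrPdist_lt/(_ _ ltr01)] := @cvg_cdfNy0 _ _ _ _ X.
move=> [M [_ h]]; exists (M - 1) => x Mx.
have /h /= : x < M by apply: le_lt_trans Mx _; rewrite ltrBlDr ltrDl.
by rewrite -/(F x) sub0r normrN ger0_norm.
Qed.

(** For x > 0, F(x) <= F(x / b) = F(x)^a <= F(x), so F(x) is 0 or 1 and F is constant along x / b^n.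
    These points tend to infinity, where F is positive. *)
Let F_pos_eq1 (x : R) : 0 < x -> F x = 1.
Proof.
have F01 (y : R) : 0 < y -> F y = F y `^ a /\ F (y / b) = F y.
  move=> y0; suff h : F y = F y `^ a by rewrite Fa -h.
  apply/eqP; rewrite eq_le -{1}Fa Fmono/=; last first.
    by rewrite ler_pdivlMr// ler_piMr// ltW.
  have [->|Fy0] := eqVneq (F y) 0; first by rewrite powR0// gt_eqF.
  by apply: ge1r_powR; rewrite ?(ltW a1)// lt_def Fy0 F0 F1.
move=> x0; have [M hM] := F_cvg1.
have [n hn] := expr_unbounded (M / x) r1.
have Fn m : F (x * b^-1 ^+ m) = F x.
  elim: m => [|m IH]; first by rewrite mulr1.
  by rewrite exprSr mulrA (F01 _ _).2 ?mulr_gt0 ?exprn_gt0 ?invr_gt0.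
case: (F_fixed (F01 _ x0).1) => [Fx0|//].
have := hM (x * b^-1 ^+ n); rewrite Fn Fx0 ltxx mulrC -ler_pdivrMr// => /(_ hn).
by [].
Qed.

Let F_ge0_eq1 (x : R) : 0 <= x -> F x = 1.
Proof.
rewrite le_eqVlt => /predU1P[<-|]; last exact: F_pos_eq1.
have : F y @[y --> 0^'+] --> F 0.
  by have := @cdf_right_continuous _ _ _ _ X 0; rewrite cdfE => /fine_cvgP[].
move=> Fcvg; apply: (cvg_unique _ Fcvg) => //; apply: cvg_near_cst.
near=> y; apply: F_pos_eq1; near: y; exact: nbhs_right_gt.
Unshelve. all: by end_near. Qed.

(** A value 1 at x < 0 would persist along x / b^n, which tends to minus infinity. *)
Let F_neg_lt1 (x : R) : x < 0 -> F x < 1.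
Proof.
move=> x0; rewrite lt_def F1 andbT eq_sym; apply/eqP => Fx1.
have [M hM] := F_cvg0.
have Fn m : F (x * b^-1 ^+ m) = 1.
  elim: m => [|m IH]; first by rewrite mulr1.
  by rewrite exprSr mulrA Fa IH powR1.
have [n hn] := expr_unbounded (M / x) r1.
have := hM (x * b^-1 ^+ n); rewrite Fn ltxx mulrC -ler_ndivrMr// => /(_ hn).
by [].
Qed.

(** A zero at x < 0 would propagate along x b^n, which increases to 0, and by monotonicity to the
    whole negative half-line. Then [X] would be concentrated at 0, against non-degeneracy. *)
Let F_neg_gt0 (x : R) : x < 0 -> 0 < F x.
Proof.
move=> x0; rewrite lt_def F0 andbT; apply/eqP => Fx0.
have Fn m : F (x * b ^+ m) = 0.
  elim: m => [|m IH]; first by rewrite mulr1.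
  apply: (@powR_eq0_eq0 _ _ a); rewrite -Fa exprSr mulrA mulfK ?gt_eqF//.
have Fneg (y : R) : y < 0 -> F y = 0.
  move=> y0; have [n hn] := expr_unbounded (x / y) r1.
  apply/eqP; rewrite eq_le F0 andbT -(Fn n); apply: Fmono.
  by move: hn; rewrite ler_ndivrMr// exprVn mulrC ler_pdivrMr ?exprn_gt0.
apply: Xnd; exists 0.
have : cdf X 0 = 1%E by rewrite cdfE F_ge0_eq1.
rewrite /cdf (_ : `]-oo, 0]%classic = `]-oo, 0[%classic `|` [set 0]); last first.
  by apply/seteqP; split => y; rewrite /= !in_itv/= le_eqVlt;
    [move/orP => [/eqP|]; by [right|left]|move=> [->|->]; rewrite ?orbT ?eqxx].
have neg0 : distribution P X `]-oo, (0:R)[ = 0%E.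
  apply: measure_negligible => //.
  apply: (@negligibleS _ _ _ _ (\bigcup_k `]-oo, - k.+1%:R^-1 : R]%classic)).
    move=> y; rewrite /= in_itv/= => y0.
    have Ny0 : 0 < - y by rewrite oppr_gt0.
    (* With k the integer part of 1 / (-y), one has 1 / (k + 1) <= -y. *)
    exists (Num.trunc (- y)^-1) => //=; rewrite in_itv/= lerNr -[leRHS]invrK.
    by rewrite lef_pV2 ?posrE ?invr_gt0// ltW// truncnS_gt.
  apply: negligible_bigcup => k; apply/negligibleP => //.
  have := cdfE (- k.+1%:R^-1); rewrite Fneg ?oppr_lt0 ?invr_gt0//.
by rewrite setUC measureU0.
Qed.

(** The only possible choice: the Weibull form at x = -e^y, solved for h. *)
Let h y := - ln (F (- expR y)) * expR (- (alpha * y)).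

Lemma ext_weibull_mss_semistable : ext_weibull_mss alpha a b X.
Proof.
have p0 : 0 < `|ln b| by rewrite normr_gt0 lt_eqF// ln_lt0.
have lnbE : `|ln b| = - ln b by rewrite ltr0_norm// ln_lt0.
have Fneg y : 0 < F (- expR y) < 1.
  by rewrite F_neg_gt0 ?F_neg_lt1// oppr_lt0 expR_gt0.
have h0 y : 0 < h y.
  by rewrite mulr_gt0 ?expR_gt0// oppr_gt0 ln_lt0.
(* The shift divides -e^y by b, which multiplies ln F by a, while the exponential weight gains the
   factor b^alpha = 1 / a. *)
have hper y : h (y + `|ln b|) = h y.
  have scale : - expR (y - ln b) = - expR y / b.
    by rewrite expRD expRN lnK ?posrE// mulNr.
  have weight : expR (- (alpha * (y - ln b))) = expR (- (alpha * y)) * b `^ alpha.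
    rewrite mulrBr opprB addrC expRD; congr (_ * _).
    by rewrite -ln_powR lnK ?posrE ?powR_gt0.
  rewrite /h lnbE scale weight Fa ln_powR.
  rewrite /a powRN; set B := b `^ alpha.
  have B0 : B != 0 by rewrite gt_eqF// powR_gt0.
  by field.
split => //.
  by split => //; rewrite /a powRN mulVf// gt_eqF// powR_gt0.
exists h; split => //.
(* By periodicity x is reduced to the period [0, |ln b|]. There -ln F(-e^y) is largest at the right
   end and the weight is at most 1. *)
- exists (- ln (F (- expR `|ln b|))) => x.
  pose m := Num.floor (x / `|ln b|).
  have /andP[m1 m2] := floor_itv (x / `|ln b|).
  pose y := x - m%:~R * `|ln b|.
  have y0 : 0 <= y by rewrite subr_ge0 -ler_pdivlMr.
  have y1 : y <= `|ln b|.
    rewrite lerBlDr -[X in X + _]mul1r -mulrDl -ler_pdivrMr// addrC.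
    by move: m2; rewrite intrD => /ltW.
  rewrite -(subrK (m%:~R * `|ln b|) x) periodic_intz// -/y.
  rewrite -[leRHS]mulr1; apply: ler_pM.
  + by rewrite oppr_ge0 ltW// ln_lt0.
  + exact: expR_ge0.
  + rewrite lerN2 ler_ln ?posrE ?F_neg_gt0 ?oppr_lt0 ?expR_gt0//.
    by apply: Fmono; rewrite lerN2 ler_expR.
  + by rewrite -expR0 ler_expR oppr_le0 mulr_ge0// ltW.
- move=> x x0; rewrite cdfE ltr0_norm//.
  have Nx0 : 0 < - x by rewrite oppr_gt0.
  have weight : expR (- (alpha * ln (- x))) = ((- x) `^ alpha)^-1.
    by rewrite -ln_powR expRN lnK// posrE powR_gt0.
  rewrite /h weight lnK ?posrE// opprK mulrC mulfVK.
    by rewrite opprK lnK// posrE F_neg_gt0.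
  by rewrite gt_eqF// powR_gt0.
- by move=> x x0; rewrite cdfE F_ge0_eq1.
Qed.

End ExtendedWeibull.

(** * The max-autoregressive recursion and its future noise *)

Section MaxAutoregression.
Context {d : measure_display} {T : measurableType d} {R : realType}.
Context (Q : probability T R) (X eps : nat -> {RV Q >-> R}) (rho : R).
Hypothesis rho0 : 0 < rho.
Hypothesis eps_indep : mutually_independent Q (fun n => eps n : T -> R)
  [set n | (1 <= n)%N].
Hypothesis X0_indep : independent_of_family Q (X 0%N) (fun n => eps n : T -> R)
  [set n | (1 <= n)%N].
Hypothesis X_rec : forall n, (1 <= n)%N -> forall w,
  X n w = Num.max (rho * X n.-1 w) (eps n w).

Let X_le n u : X n.+1 @^-1` `]-oo, u] =
  X n @^-1` `]-oo, u / rho] `&` eps n.+1 @^-1` `]-oo, u].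
Proof.
apply/seteqP; split => w; rewrite /= !in_itv/= (X_rec (ltn0Sn n)) ge_max ler_pdivlMr//;
  rewrite [rho * _]mulrC; first by move/andP.
by move=> [-> ->].
Qed.

Let eps_event (s : seq nat) (v : nat -> R) : set T :=
  \big[setI/[set: T]]_(i <- s) (eps i @^-1` `]-oo, v i]).

(** Any finite set of later noise terms is allowed so that the induction closes: [X n.+1 <= u]
    splits into a bound on [X n] and one on [eps n.+1], and the latter joins the later terms. *)
Let X_indep_future n s (u : R) (v : nat -> R) :
  uniq s -> (forall i, i \in s -> (n < i)%N) ->
  Q (X n @^-1` `]-oo, u] `&` eps_event s v) =
  (Q (X n @^-1` `]-oo, u]) * \prod_(i <- s) Q (eps i @^-1` `]-oo, v i]))%E.
Proof.
elim: n s u v => [|n IH] s u v us ns.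
  rewrite X0_indep//; last first.
    rewrite /eps_event big_seq; elim/big_ind: _ => [|A B|i /ns i0].
    - exact: sigma_family_setT.
    - exact: sigma_family_setI.
    - exact: (@sigma_family_le _ _ _ _ (fun n => eps n : T -> R)).
  by congr (_ * _)%E; apply: (eps_indep us).
have nns : n.+1 \notin s by apply/negP => /ns; rewrite ltnn.
pose v' i := if i == n.+1 then u else v i.
have v's i : i \in s -> v' i = v i.
  by move=> si; rewrite /v' ifN//; apply: contraNneq nns => <-.
have v'n : v' n.+1 = u by rewrite /v' eqxx.
rewrite X_le -setIA.
have -> : eps n.+1 @^-1` `]-oo, u] `&` eps_event s v = eps_event (n.+1 :: s) v'.
  rewrite /eps_event big_cons v'n; congr (_ `&` _).
  by rewrite big_seq [RHS]big_seq; apply: eq_bigr => i /v's ->.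
rewrite IH ?big_cons/= ?nns//; last first.
  by move=> i; rewrite inE => /predU1P[->//|/ns]; exact: ltnW.
(* The singleton instance folds the first two factors back into the probability of [X n.+1 <= u]. *)
have := IH [:: n.+1] (u / rho) v' isT.
rewrite /eps_event !big_cons !big_nil setIT mule1 v'n => -> /=; last first.
  by move=> i; rewrite inE => /eqP->.
rewrite muleA; congr (_ * _)%E.
by rewrite big_seq [RHS]big_seq; apply: eq_bigr => i /v's ->.
Qed.

Lemma cdf_max_autoregression n u :
  cdf (X n.+1) u = (cdf (X n) (u / rho) * cdf (eps n.+1) u)%E.
Proof.
have := @X_indep_future n [:: n.+1] (u / rho) (fun=> u) isT.
rewrite /eps_event !big_cons !big_nil setIT mule1 -X_le; apply.
by move=> i; rewrite inE => /eqP->.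
Qed.

End MaxAutoregression.

(** * Semi-selfsimilarity and marginal stationarity *)

Theorem mainTheorem3 (R : realType) (alpha b a rho : R)
    (halpha : 0 < alpha) (hb : 0 < b < 1)
    (ha : a = b `^ (- alpha)) (hrho : rho = 1 / b)
    (d : measure_display) (T : measurableType d) (P : probability T R)
    (Y : R -> {RV P >-> R})
    (hY : stationary_extremal_process Y) (hY1 : nondegenerate_rv (Y 1))
    (d' : measure_display) (T' : measurableType d') (Q : probability T' R)
    (X eps : nat -> {RV Q >-> R})
    (hX0 : eq_law Q P (X 0%N) (Y 1))
    (heps_law : forall n : nat, (1 <= n)%N ->
       eq_law Q P (eps n) (fun w => rho * Y (b `^ (- alpha) - 1) w))
    (heps_indep : mutually_independent Q (fun n => eps n : T' -> R)
       [set n | (1 <= n)%N])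
    (hX0_indep : independent_of_family Q (X 0%N) (fun n => eps n : T' -> R)
       [set n | (1 <= n)%N])
    (hX : forall n : nat, (1 <= n)%N -> forall w : T',
       X n w = Num.max (rho * X n.-1 w) (eps n w)) :
  (semi_selfsimilar a (- (1 / alpha)) Y ->
     marginally_stationary X /\
     forall n : nat, ext_weibull_mss alpha a b (X n)) /\
  (marginally_stationary X ->
     semi_selfsimilar a (- (1 / alpha)) Y /\
     forall n : nat, ext_weibull_mss alpha a b (X n)).
Proof.
case/andP: (hb) => b0 b1.
have rho0 : 0 < rho by rewrite hrho divr_gt0.
have rhoV u : u / rho = u * b by rewrite hrho mul1r invrK.
have a1 : 1 < a by rewrite ha powRN_gt1.
have a0 : 0 < a by exact: lt_trans a1.
have Ycdf t u : 0 < t -> cdf (Y t) u = (cdf (Y 1%R) u `^ t)%E.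
  by case: hY => U [_ _]; exact.
have X0cdf u : cdf (X 0%N) u = cdf (Y 1) u by exact: hX0.
have epscdf n u : cdf (eps n.+1) u = (cdf (Y 1%R) (u * b) `^ (a - 1))%E.
  rewrite -Ycdf ?subr_gt0//.
  have -> : cdf (eps n.+1) u = Q (eps n.+1 @^-1` `]-oo, u]) by [].
  rewrite heps_law// -ha -rhoV.
  congr (P _); apply/seteqP; split => w;
    by rewrite /= !in_itv/= ler_pdivlMr// mulrC.
have Xcdf := cdf_max_autoregression rho0 heps_indep hX0_indep hX.
have power_split u : (cdf (Y 1%R) u * cdf (Y 1%R) u `^ (a - 1) = cdf (Y 1%R) u `^ a)%E.
  have Gfin : cdf (Y 1) u \is a fin_num by exact: fin_num_measure.
  rewrite -(fineK Gfin) !poweR_EFin -EFinM mulr_powRB1//.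
  by rewrite fine_ge0// cdf_ge0.
have weibull : (forall u, cdf (Y 1) (u / b) = (cdf (Y 1%R) u `^ a)%E) ->
    (forall n, cdf (X n) =1 cdf (Y 1)) -> forall n, ext_weibull_mss alpha a b (X n).
  move=> semi XY n; rewrite ha; apply: ext_weibull_mss_semistable => //.
    move=> [c hc]; apply: hY1; exists c; rewrite -hc.
    by apply/esym; apply: (eq_law_cdf (XY n)).
  by move=> u; rewrite !XY semi ha.
(* The space scaling c^H of the semi-selfsimilarity is exactly [b]. *)
have abE : a `^ (- (1 / alpha)) = b.
  rewrite ha -powRrM mulrNN mul1r mulfV ?powRr1//; first exact: ltW.
  by rewrite gt_eqF.
split.
- move=> ss.
  have semi u : cdf (Y 1) (u / b) = (cdf (Y 1%R) u `^ a)%E.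
    rewrite -Ycdf//.
    have := ss 1%N (fun=> 1) (fun=> ltr01) ((fun v => tnth v ord0) @^-1` `]-oo, u]).
    rewrite abE mulr1 => /(_ _)/esym.
    have YE : (fun w => [tuple b * Y 1%R w | _ < 1]) @^-1`
        ((fun v => tnth v ord0) @^-1` `]-oo, u]) = Y 1 @^-1` `]-oo, u / b].
      apply/seteqP; split => w;
        by rewrite /= tnth_mktuple !in_itv/= ler_pdivlMr// mulrC.
    have YaE : (fun w => [tuple Y a w | _ < 1]) @^-1`
        ((fun v => tnth v ord0) @^-1` `]-oo, u]) = Y a @^-1` `]-oo, u].
      by apply/seteqP; split => w; rewrite /= tnth_mktuple.
    rewrite YE YaE; apply.
    by rewrite -[X in measurable X]setTI; exact: measurable_tnth.
  have XY n : cdf (X n) =1 cdf (Y 1).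
    elim: n => [|n IH] u; first exact: X0cdf.
    (* P(X_(n+1) <= u) = G(bu) G(bu)^(a - 1) = G(bu)^a = G(u). *)
    by rewrite Xcdf IH epscdf rhoV power_split -semi mulfK// gt_eqF.
  split; last exact: weibull.
  by case=> // n _; apply: eq_law_cdf => u; rewrite !XY.
- move=> stat.
  have XY n : cdf (X n) =1 cdf (Y 1).
    elim: n => [|n IH] u; first exact: X0cdf.
    by rewrite -IH; exact: (stat n.+1).
  have semi u : cdf (Y 1) (u / b) = (cdf (Y 1%R) u `^ a)%E.
    (* The recursion from [X 0] to [X 1], read at u / b, already yields the functional equation. *)
    by rewrite -(XY 1%N) Xcdf X0cdf epscdf rhoV divfK ?gt_eqF// power_split.
  split; last exact: weibull.
  move=> k t t0; rewrite abE.
  apply: eq_law_tuple => [i|i|s].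
  + exact: measurable_funP.
  + exact: measurable_funM.
  (* Indices are replaced by the times themselves, which may coincide. *)
  pose s' := [seq (t p.1, p.2) | p <- s].
  have E (Z : R -> T -> R) : le_event (fun i => Z (t i)) s = le_event Z s'.
    by rewrite /le_event/s'; apply/seteqP; split => w; rewrite /= all_map.
  rewrite (E (fun t => Y (a * t))) (E (fun t w => b * Y t w)).
  apply: extremal_process_le_event => //.
    by move=> u r r0; rewrite semi poweRrM.
  by rewrite all_map; apply/allP => p _ /=.
Qed.
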